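(* Let $p\ge 1$ and let $\Psi\colon C^{p\text{-var}}([0,T];G^{N}(\mathbb{R}^d))\to C^{p\text{-var}}([0,T];G^{M}(\mathbb{R}^e))$ be locally linear with $0<\|\Psi\|_R<\infty$ for some $R\in(0,\infty]$. Then $$N_{\alpha\|\Psi\|_R^p,[s,t]}(\Psi(\mathbf{x}))\le N_{\alpha,[s,t]}(\mathbf{x})$$ for every $\mathbf{x}\in C^{p\text{-var}}([0,T];G^N(\mathbb{R}^d))$, all $s<t$ in $[0,T]$ and every (finite) $\alpha\in(0,R^p]$.
   Context: $G^N(\mathbb{R}^d)$ is the step-$N$ free nilpotent group over $\mathbb{R}^d$ with the Carnot–Carathéodory norm $\|\cdot\|$; for a path $\mathbf{x}$, $\mathbf{x}_{s,t}=\mathbf{x}_s^{-1}\otimes\mathbf{x}_t$ and $\|\mathbf{x}\|_{p\text{-var};[s,t]}=\left(\sup\sum_i\|\mathbf{x}_{t_i,t_{i+1}}\|^p\right)^{1/p}$, supremum over dissections of $[s,t]$. $C^{p\text{-var}}([0,T];G^N(\mathbb{R}^d))$ is the set of continuous paths of finite $p$-variation. $\omega_{\mathbf{x}}(s,t)=\|\mathbf{x}\|^p_{p\text{-var};[s,t]}$ is a control (continuous, non-negative, superadditive function of $s\le t$, zero on the diagonal). For a control $\omega$ and $\alpha>0$ set $\tau_0=s$, $\tau_{i+1}=\inf\{u:\omega(\tau_i,u)\ge\alpha,\ \tau_i<u\le t\}\wedge t$ ($\inf\emptyset=\infty$) and $N_{\alpha,[s,t]}(\omega)=\sup\{n\in\mathbb{N}\cup\{0\}:\tau_n<t\}$;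 $N_{\alpha,[s,t]}(\mathbf{x}):=N_{\alpha,[s,t]}(\omega_{\mathbf{x}})$. For a map $\Psi\colon C^{p\text{-var}}([0,T];G^{N}(\mathbb{R}^d))\to C^{p\text{-var}}([0,T];G^{M}(\mathbb{R}^e))$ and $R\in(0,\infty]$, $\|\Psi\|_R$ denotes the infimum of all $C>0$ such that $\|\Psi(\mathbf{x})\|_{p\text{-var};[u,v]}\le C\|\mathbf{x}\|_{p\text{-var};[u,v]}$ for all $0\le u\le v\le T$ and all $\mathbf{x}$ with $\|\mathbf{x}\|_{p\text{-var};[u,v]}\le R$. $\Psi$ is called locally linear if $\|\Psi\|_R<\infty$ for some $R\in(0,\infty]$. *)

(* Defs.v *)
From HB Require Import structures.
From mathcomp Require Import all_boot all_order all_algebra.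
From mathcomp Require Import all_classical all_reals all_analysis.

Set Implicit Arguments.
Unset Strict Implicit.
Unset Printing Implicit Defensive.

Import Order.TTheory GRing.Theory Num.Theory.
Import numFieldTopology.Exports numFieldNormedType.Exports.

Local Open Scope classical_set_scope.
Local Open Scope ring_scope.

(* [tens R N d] is T^N(R^d), the direct sum of the tensor powers of R^d of
   order at most N; a tensor is given by its coordinates on the words of length
   at most N in the letters ['I_d]. *)
Definition tens (R : realType) (N d : nat) := {ffun N.-bseq 'I_d -> R}.

Section TensorAlgebra.
Variables (R : realType) (N d : nat).

HB.instance Definition _ :=
  GRing.Lmodule.copy (tens R N d) {ffun N.-bseq 'I_d -> R^o}.

Definition tens_one : tens R N d := [ffun w : N.-bseq 'I_d => (nilp w)%:R].

Definition tens_mul (a b : tens R N d) : tens R N d :=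
  [ffun w : N.-bseq 'I_d => \sum_(k < (size w).+1)
     a (insub_bseq N (take k w)) * b (insub_bseq N (drop k w))].

Let conv (f g : seq 'I_d -> R) (w : seq 'I_d) : R :=
  \sum_(k < (size w).+1) f (take k w) * g (drop k w).

Let conv_nil f g : conv f g [::] = f [::] * g [::].
Proof. by rewrite /conv big_ord1. Qed.

Let conv_cons f g i w :
  conv f g (i :: w) = f [::] * g (i :: w) + conv (f \o cons i) g w.
Proof. by rewrite /conv big_ord_recl. Qed.

Let eq_conv f f' g g' w :
  (forall s, (size s <= size w)%N -> f s = f' s) ->
  (forall s, (size s <= size w)%N -> g s = g' s) ->
  conv f g w = conv f' g' w.
Proof.
move=> Hf Hg; apply: eq_bigr => k _; rewrite Hf ?Hg //.
  by rewrite size_drop leq_subr.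
by rewrite size_take_min geq_minr.
Qed.

Let convA f g h w : conv f (conv g h) w = conv (conv f g) h w.
Proof.
elim: w f => [|i w IHw] f.
  by rewrite !conv_nil mulrA.
rewrite [LHS]conv_cons [RHS]conv_cons IHw conv_cons conv_nil.
rewrite mulrDr mulrA -addrA; congr (_ + _).
have -> : conv (conv f g \o cons i) h w =
  conv (fun s => f [::] * g (i :: s) + conv (f \o cons i) g s) h w.
  by apply: eq_conv => // s _ /=; rewrite conv_cons.
rewrite /conv mulr_sumr -big_split /=; apply: eq_bigr => k _.
by rewrite mulrDl mulrA.
Qed.

Let ext (a : tens R N d) (s : seq 'I_d) : R := a (insub_bseq N s).

Let extE (a : tens R N d) (w : N.-bseq 'I_d) : ext a w = a w.
Proof. by rewrite /ext /insub_bseq valKd. Qed.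

Let val_insub (s : seq 'I_d) : (size s <= N)%N -> insub_bseq N s = s :> seq _.
Proof. by move=> Hs; rewrite /insub_bseq insubdK. Qed.

Let ext_mul a b s : (size s <= N)%N ->
  ext (tens_mul a b) s = conv (ext a) (ext b) s.
Proof. by move=> Hs; rewrite /ext ffunE val_insub. Qed.

Let ext_one s : (size s <= N)%N -> ext tens_one s = (nilp s)%:R.
Proof. by move=> Hs; rewrite /ext ffunE val_insub. Qed.

Let ext_inj (a b : tens R N d) :
  (forall s, (size s <= N)%N -> ext a s = ext b s) -> a = b.
Proof.
by move=> H; apply/ffunP => w; rewrite -!extE; apply/H/size_bseq.
Qed.

Fact tens_mulA : associative tens_mul.
Proof.
move=> a b c; apply: ext_inj => s Hs; rewrite !ext_mul //.
transitivity (conv (ext a) (conv (ext b) (ext c)) s).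
  by apply: eq_conv => // u Hu; rewrite ext_mul // (leq_trans Hu).
rewrite convA; apply: eq_conv => // u Hu.
by rewrite ext_mul // (leq_trans Hu).
Qed.

Fact tens_mul1l : left_id tens_one tens_mul.
Proof.
move=> a; apply: ext_inj => s Hs; rewrite ext_mul //.
rewrite /conv big_ord_recl take0 drop0 ext_one // mul1r big1 ?addr0 // => k _.
rewrite ext_one; last by rewrite size_take_min geq_min Hs orbT.
rewrite /nilp size_takel /=; last by case: s k {Hs} => [[]|].
by rewrite mul0r.
Qed.

Fact tens_mul1r : right_id tens_one tens_mul.
Proof.
move=> a; apply: ext_inj => s Hs; rewrite ext_mul //.
rewrite /conv big_ord_recr /= take_size drop_size ext_one // mulr1.
rewrite big1 ?add0r // => k _.
rewrite ext_one; last by rewrite size_drop (leq_trans (leq_subr _ _)).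
by rewrite /nilp size_drop subn_eq0 leqNgt ltn_ord mulr0.
Qed.

Fact tens_mulDl : left_distributive tens_mul +%R.
Proof.
move=> a b c; apply/ffunP => w; rewrite !ffunE -big_split.
by apply: eq_bigr => k _; rewrite !ffunE mulrDl.
Qed.

Fact tens_mulDr : right_distributive tens_mul +%R.
Proof.
move=> a b c; apply/ffunP => w; rewrite !ffunE -big_split.
by apply: eq_bigr => k _; rewrite !ffunE mulrDr.
Qed.

Fact tens_one_neq0 : tens_one != 0.
Proof.
by apply/eqP => /ffunP /(_ [bseq]); rewrite !ffunE => /eqP; rewrite oner_eq0.
Qed.

HB.instance Definition _ := GRing.Zmodule_isNzRing.Build (tens R N d)
  tens_mulA tens_mul1l tens_mul1r tens_mulDl tens_mulDr tens_one_neq0.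

Fact tens_scalerAl (c : R) (a b : tens R N d) : c *: (a * b) = (c *: a) * b.
Proof.
apply/ffunP => w; rewrite !ffunE [LHS]mulr_sumr.
by apply: eq_bigr => k _; rewrite !ffunE; exact: mulrA.
Qed.

HB.instance Definition _ :=
  GRing.Lmodule_isLalgebra.Build R (tens R N d) tens_scalerAl.

Fact tens_scalerAr (c : R) (a b : tens R N d) : c *: (a * b) = a * (c *: b).
Proof.
apply/ffunP => w; rewrite !ffunE [LHS]mulr_sumr.
by apply: eq_bigr => k _; rewrite !ffunE; exact: mulrCA.
Qed.

HB.instance Definition _ :=
  GRing.Lalgebra_isAlgebra.Build R (tens R N d) tens_scalerAr.

Definition scalar_part (a : tens R N d) : R := a [bseq].

(* Neumann series; it is finite because a tensor without scalar part is
   nilpotent. *)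
Definition tens_inv (a : tens R N d) : tens R N d :=
  let c := scalar_part a in
  if c == 0 then a else c^-1 *: \sum_(k < N.+1) (1 - c^-1 *: a) ^+ k.

Let scalar_partM a b : scalar_part (a * b) = scalar_part a * scalar_part b.
Proof.
rewrite /scalar_part ffunE /= big_ord1 /=.
by congr (a _ * b _); apply: val_inj; rewrite /= val_insub.
Qed.

Let scalar_part1 : scalar_part 1 = 1.
Proof. by rewrite /scalar_part ffunE. Qed.

Let tens_nilp (y : tens R N d) : scalar_part y = 0 -> y ^+ N.+1 = 0.
Proof.
move=> y0; suff H n s : (size s < n)%N -> (size s <= N)%N -> ext (y ^+ n) s = 0.
  apply: ext_inj => s Hs; rewrite H //.
  by rewrite /ext ffunE.
elim: n s => // n IHn s; rewrite ltnS => Hn Hs; rewrite exprS.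
rewrite [LHS]ext_mul // /conv big_ord_recl take0.
have -> : ext y [::] = 0.
  by rewrite -y0 /ext /scalar_part; congr (y _); apply: val_inj; rewrite /= val_insub.
rewrite mul0r add0r big1 // => k _; rewrite IHn ?mulr0 // size_drop.
  apply: leq_trans Hn; case: s k {Hs} => [|i s] k /=; first by case: k.
  by rewrite /bump add1n subSS ltnS leq_subr.
exact: leq_trans (leq_subr _ _) Hs.
Qed.

Let tens_inv_both (a : tens R N d) : scalar_part a != 0 ->
  tens_inv a * a = 1 /\ a * tens_inv a = 1.
Proof.
move=> a0; rewrite /tens_inv (negPf a0).
set c := scalar_part a; set y := 1 - c^-1 *: a.
have ay : c^-1 *: a = 1 - y by rewrite /y opprB addrC subrK.
have y0 : scalar_part y = 0.
  rewrite /y /scalar_part !ffunE /= -/(scalar_part a) -/c.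
  by rewrite /GRing.scale /= mulVf // subrr.
have E : (1 - y) * (\sum_(k < N.+1) y ^+ k) = 1.
  by apply: oppr_inj; rewrite -mulNr opprB -subrX1 tens_nilp // sub0r.
have C : GRing.comm (1 - y) (\sum_(k < N.+1) y ^+ k).
  apply: commr_sum => k _; apply: commrX; apply: commr_sym; apply: commrB.
    exact: commr1.
  by [].
split.
  by rewrite -scalerAl scalerAr ay -C.
by rewrite -scalerAr scalerAl ay.
Qed.

Fact tens_mulVr :
  {in [pred a | scalar_part a != 0], left_inverse 1 tens_inv *%R}.
Proof. by move=> a /tens_inv_both []. Qed.

Fact tens_mulrV :
  {in [pred a | scalar_part a != 0], right_inverse 1 tens_inv *%R}.
Proof. by move=> a /tens_inv_both []. Qed.

Fact tens_unitP (a b : tens R N d) :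
  b * a = 1 /\ a * b = 1 -> [pred a | scalar_part a != 0] a.
Proof.
case=> /(congr1 scalar_part); rewrite scalar_partM scalar_part1 => E _ /=.
by apply/eqP => a0; move/eqP: E; rewrite a0 mulr0 eq_sym oner_eq0.
Qed.

Fact tens_inv_out :
  {in [predC [pred a | scalar_part a != 0]], tens_inv =1 id}.
Proof. by move=> a; rewrite inE /= negbK /tens_inv => ->. Qed.

HB.instance Definition _ := GRing.NzRing_hasMulInverse.Build (tens R N d)
  tens_mulVr tens_mulrV tens_unitP tens_inv_out.

Definition letter (i : 'I_d) : tens R N d :=
  [ffun w : N.-bseq 'I_d => (val w == [:: i])%:R].

Definition lie_subalgebra (L : set (tens R N d)) : Prop :=
  [/\ L 0,
      forall (c : R) a b, L a -> L b -> L (c *: a + b) &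
      forall a b, L a -> L b -> L (a * b - b * a)].

(* R^d + [R^d, R^d] + ... , the Lie subalgebra of T^N(R^d) generated by R^d. *)
Definition free_nilpotent_lie : set (tens R N d) :=
  smallest lie_subalgebra (range letter).

(* On tensors without scalar part the exponential series stops at order N. *)
Definition tens_exp (a : tens R N d) : tens R N d :=
  \sum_(k < N.+1) (k`!%:R)^-1 *: a ^+ k.

Definition free_nilpotent_group : set (tens R N d) :=
  tens_exp @` free_nilpotent_lie.

End TensorAlgebra.

Arguments free_nilpotent_group : clear implicits.

Section Signature.
Variable R : realType.

(* [D a b] is the size of the increment over [a, b]. *)
Definition pvariation (p : R) (D : R -> R -> \bar R) (u v : R) : \bar R :=
  (poweR (ereal_sup
    [set (\sum_(0 <= i < size s)
            poweR (D (nth v (u :: s) i) (nth v (u :: s) i.+1)) p)%E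
    | s in [set s | itv_partition u v s]]) p^-1)%E.

(* Limit of the Riemann-Stieltjes sums as the mesh tends to 0; the division
   points are [u :: s] and [xi i] is the tag of the i-th subinterval. *)
Definition is_RS_integral (f g : R -> R) (u v I : R) : Prop :=
  forall e : R, 0 < e -> exists2 delta : R, 0 < delta &
    forall (s : seq R) (xi : nat -> R), itv_partition u v s ->
      (forall i, (i < size s)%N ->
         nth v (u :: s) i <= xi i <= nth v (u :: s) i.+1 /\
         nth v (u :: s) i.+1 - nth v (u :: s) i < delta) ->
      `| \sum_(0 <= i < size s)
           f (xi i) * (g (nth v (u :: s) i.+1) - g (nth v (u :: s) i)) - I | < e.

Definition RS_integral (f g : R -> R) (u v : R) : R :=
  xget 0 [set I | is_RS_integral f g u v I].

Section Paths.
Variable d : nat.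
Implicit Type gamma : R -> 'rV[R]_d.

(* The last letter of a word is integrated last, so the recursion is on the
   reversed word. *)
Fixpoint iterated_integral gamma (w : seq 'I_d) (t : R) : R :=
  if w is i :: w' then
    RS_integral (iterated_integral gamma w') (fun u => gamma u 0 i) 0 t
  else 1.

Definition signature (N : nat) gamma : tens R N d :=
  [ffun w : N.-bseq 'I_d => iterated_integral gamma (rev w) 1].

Definition euclidean_norm (v : 'rV[R]_d) : R :=
  Num.sqrt (\sum_(i < d) v 0 i ^+ 2).

Definition path_length gamma : \bar R :=
  pvariation 1 (fun s t => (euclidean_norm (gamma t - gamma s))%:E) 0 1.

(* The infimum is taken in [\bar R], so that it is +oo where no path exists;
   by Chow's theorem this does not happen on the free nilpotent group. *)
Definition cc_norm (N : nat) (g : tens R N d) : \bar R :=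
  ereal_inf [set path_length gamma | gamma in
    [set gamma : R -> 'rV[R]_d |
                 [/\ {within `[0, 1], continuous gamma},
                     (path_length gamma < +oo)%E &
                     signature N gamma = g]]].

End Paths.
End Signature.

Section PvarPaths.
Variable R : realType.

Definition pvar_norm (N d : nat) (p : R) (x : R -> tens R N d) (u v : R) :
    \bar R :=
  pvariation p (fun s t => cc_norm ((x s)^-1 * x t)) u v.

(* A path on [0, T] is encoded by the function on R that agrees with it on
   [0, T] and takes the value 1 elsewhere, so that distinct inhabitants are
   distinct paths on [0, T].  Continuity is with respect to the
   Carnot-Caratheodory metric. *)
Record pvar_path (p T : R) (N d : nat) := PvarPath {
  path_fun :> R -> tens R N d;
  path_in_group : forall t, t \in `[0, T] ->
    free_nilpotent_group R N d (path_fun t);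
  path_out : forall t, t \notin `[0, T] -> path_fun t = 1;
  path_continuous : forall s, s \in `[0, T] ->
    cc_norm ((path_fun s)^-1 * path_fun t) @[t --> within `[0, T] (nbhs s)] --> 0%E;
  path_pvar : (pvar_norm p path_fun 0 T < +oo)%E
}.

Definition omega (p T : R) (N d : nat) (x : pvar_path p T N d) (u v : R) :
    \bar R :=
  poweR (pvar_norm p x u v) p.

(* The infimum in [\bar R] is +oo on the empty set, and the minimum with [t] is
   always finite when [s <= t], so [fine] loses nothing. *)
Fixpoint greedy_time (w : R -> R -> \bar R) (alpha : \bar R) (s t : R)
    (n : nat) : R :=
  if n is n'.+1 then
    let tau := greedy_time w alpha s t n' in
    fine (mine (ereal_inf [set u%:E | u in
                  [set u | (alpha <= w tau u)%E /\ tau < u <= t]]) t%:E)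
  else s.

(* The supremum of a set of naturals, +oo if the set is unbounded. *)
Definition greedy_count (w : R -> R -> \bar R) (alpha : \bar R) (s t : R) :
    \bar R :=
  ereal_sup [set n%:R%:E | n in [set n : nat | greedy_time w alpha s t n < t]].

Section LocallyLinear.
Variables (p T : R) (N d M e : nat).
Variable Psi : pvar_path p T N d -> pvar_path p T M e.

(* The infimum is +oo if no constant is admissible. *)
Definition lin_norm (r : \bar R) : \bar R :=
  ereal_inf [set C%:E | C in [set C : R | 0 < C /\
    forall u v : R, 0 <= u -> u <= v -> v <= T ->
    forall x : pvar_path p T N d, (pvar_norm p x u v <= r)%E ->
      (pvar_norm p (Psi x) u v <= C%:E * pvar_norm p x u v)%E]].

Definition locally_linear : Prop :=
  exists r : \bar R, (0 < r)%E /\ (lin_norm r < +oo)%E.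

End LocallyLinear.
End PvarPaths.

(* Main.v *)
Require Import Defs.
From mathcomp Require Import all_boot all_order all_algebra.
From mathcomp Require Import all_classical all_reals all_analysis.

Import Order.TTheory GRing.Theory Num.Theory.

Local Open Scope ring_scope.

(* The greedy times of [Psi x] at level [alpha * ||Psi||_R^p] never fall behind
   those of [x] at level [alpha].  If [tau <= sigma] are the current times and
   [omega x tau u < alpha], then [omega x sigma u < alpha <= R^p] by
   monotonicity of the p-variation, so local linearity applies on [sigma, u] and
   [omega (Psi x) sigma u <= ||Psi||_R^p * omega x sigma u
    < alpha * ||Psi||_R^p]. *)

(** For [a > 0] divide by [a]: then [b / a] is a lower bound of [S]. This is what makes the infimum
    [lin_norm] itself an admissible constant. *)
Lemma ereal_inf_mulr_ge (R : realType) (S : set R) (a b : \bar R) :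
  (ereal_inf [set C%:E | C in S] < +oo)%E ->
  (0 <= a < +oo)%E -> (0 <= b)%E ->
  (forall C, S C -> (b <= C%:E * a)%E) ->
  (b <= ereal_inf [set C%:E | C in S] * a)%E.
Proof.
move=> inf_fin /andP[a0 a_fin] b0 bS.
(* An infimum below [+oo] forces [S] to be nonempty; the element [C0] rules out [b = +oo] and
   settles [a = 0]. *)
have [_ [C0 SC0 _] _] := ereal_inf_lt inf_fin.
have afin : a \is a fin_num by rewrite ge0_fin_numE.
move: a0 b0 bS afin {a_fin}; case: a => [a| |] // a0.
case: b => [b| |] // b0 bS _; last by have := bS _ SC0; rewrite -EFinM.
have [a_eq0|a_neq0] := eqVneq a 0.
  by have := bS _ SC0; rewrite a_eq0 !mule0.
have a_gt0 : 0 < a by rewrite lt_neqAle eq_sym a_neq0 -lee_fin.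
rewrite -lee_pdivrMr //; apply: le_ereal_inf_tmp => _ [C SC <-].
by rewrite lee_pdivrMr // bS.
Qed.

(** The outer power cancels the root [p^-1] because the supremum is nonnegative: partitions of
    [[u, v]] exist and their sums have nonnegative terms. *)
Lemma poweR_pvariation (R : realType) (p : R) (D : R -> R -> \bar R) (u v : R) :
  0 < p -> u <= v ->
  poweR (pvariation p D u v) p =
  ereal_sup [set (\sum_(0 <= i < size s)
            poweR (D (nth v (u :: s) i) (nth v (u :: s) i.+1)) p)%E
    | s in [set s | itv_partition u v s]]%classic.
Proof.
move=> p0 uv; rewrite /pvariation -poweRrM mulVf ?gt_eqF // poweRe1 //.
have [s us] : exists s, itv_partition u v s.
  move: uv; rewrite le_eqVlt => /predU1P[->|uv]; first by exists [::].
  by exists [:: v]; exact: itv_partition1.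
apply: le_ereal_sup_tmp; eexists; first by exists s.
by apply: sume_ge0 => i _; exact: poweR_ge0.
Qed.

(** When [a < u], a partition of [[u, v]] preceded by the interval [[a, u]] partitions [[a, v]], and
    its sum gains one nonnegative term. *)
Lemma poweR_pvariation_subitv (R : realType) (p : R) (D : R -> R -> \bar R)
    (a u v : R) : 0 < p -> a <= u -> u <= v ->
  (poweR (pvariation p D u v) p <= poweR (pvariation p D a v) p)%E.
Proof.
move=> p0; rewrite le_eqVlt => /predU1P[->//|au] uv.
rewrite !poweR_pvariation // ?(le_trans (ltW au)) //.
apply: ge_ereal_sup => _ [s [us /eqP lasts] <-].
apply: le_ereal_sup_tmp; eexists.
  by exists (u :: s) => //; split; rewrite /= ?au // lasts.
rewrite [leRHS]big_nat_recl //= leeDr ?poweR_ge0 //.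
Qed.

Lemma pvariation_lin_norm (R : realType) (p T : R) (N d M e : nat)
    (Psi : pvar_path p T N d -> pvar_path p T M e) (r : \bar R)
    (x : pvar_path p T N d) (u v : R) :
  (lin_norm Psi r < +oo)%E -> 0 <= u -> u <= v -> v <= T ->
  (pvar_norm p x u v <= r)%E -> (pvar_norm p x u v < +oo)%E ->
  (pvar_norm p (Psi x) u v <= lin_norm Psi r * pvar_norm p x u v)%E.
Proof.
move=> K_fin u0 uv vT xr x_fin; apply: ereal_inf_mulr_ge => //.
- by rewrite poweR_ge0.
- exact: poweR_ge0.
- by move=> C [_]; exact.
Qed.

(** Here [m] is the extended real under [fine] in [greedy_time]; these bounds make it finite, so
    [fine] preserves order there. *)
Lemma greedy_step_itv (R : realType) (P : R -> Prop) (tau t : R) : tau <= t ->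
  let m := mine (ereal_inf [set u%:E | u in
                  [set u | P u /\ tau < u <= t]]%classic) t%:E in
  (tau%:E <= m <= t%:E)%E.
Proof.
move=> tau_t /=; rewrite ge_min lexx orbT le_min lee_fin tau_t !andbT.
by apply: le_ereal_inf_tmp => _ [u [_ /andP[/ltW tau_u _]] <-].
Qed.

Lemma fin_num_itv (R : realType) (a b : R) (x : \bar R) :
  (a%:E <= x <= b%:E)%E -> x \is a fin_num.
Proof. by case: x => [x| |] //; rewrite ?leeNy_eq ?leye_eq ?andbF. Qed.

Lemma greedy_time_itv (R : realType) (w : R -> R -> \bar R) (a : \bar R)
    (s t : R) (n : nat) : s <= t -> s <= greedy_time w a s t n <= t.
Proof.
move=> st; elim: n => [|n /andP[IHs IHt]] /=; first by rewrite lexx st.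
have := greedy_step_itv _
  (fun u => (a <= w (greedy_time w a s t n) u)%E) _ _ IHt.
case: mine => [m| |] /andP[] //.
by rewrite !lee_fin => /(le_trans IHs) ->.
Qed.

(** Induction on [n]: if [tau <= sigma] are the current times, every candidate [u] for the next time
    after [sigma] is also one after [tau], and the infimum over the larger set is smaller. *)
Lemma greedy_time_le (R : realType) (w w' : R -> R -> \bar R) (a a' : \bar R)
    (s t : R) (n : nat) : s <= t ->
  (forall tau sigma u, s <= tau -> tau <= sigma -> sigma < u -> u <= t ->
     (a' <= w' sigma u)%E -> (a <= w tau u)%E) ->
  greedy_time w a s t n <= greedy_time w' a' s t n.
Proof.
move=> st ww'; elim: n => //= n IHn.
have /andP[s_tau tau_t] := greedy_time_itv _ w a _ _ n st.
have /andP[_ sigma_t] := greedy_time_itv _ w' a' _ _ n st.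
apply: fine_le.
- exact: fin_num_itv (greedy_step_itv _ _ _ _ tau_t).
- exact: fin_num_itv (greedy_step_itv _ _ _ _ sigma_t).
apply: le_min2 => //; apply: ereal_inf_le_tmp.
apply: image_subset => u [w'u /andP[sigma_u ut]].
split; first exact: ww' w'u.
by rewrite ut (le_lt_trans IHn).
Qed.

Lemma greedy_count_le (R : realType) (w w' : R -> R -> \bar R) (a a' : \bar R)
    (s t : R) : s <= t ->
  (forall tau sigma u, s <= tau -> tau <= sigma -> sigma < u -> u <= t ->
     (a' <= w' sigma u)%E -> (a <= w tau u)%E) ->
  (greedy_count w' a' s t <= greedy_count w a s t)%E.
Proof.
move=> st ww'; apply: ereal_sup_le; apply: image_subset => n /=.
by apply: le_lt_trans; exact: greedy_time_le.
Qed.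

Theorem proposition2 (R : realType) (p T : R) (N d M e : nat)
    (Psi : pvar_path p T N d -> pvar_path p T M e) (r : \bar R)
    (hp : 1 <= p) (hT : 0 < T)
    (hPsi : locally_linear Psi)
    (hr : (0 < r)%E)
    (hPsi_gt0 : (0 < lin_norm Psi r)%E)
    (hPsi_fin : (lin_norm Psi r < +oo)%E)
    (x : pvar_path p T N d) (s t : R)
    (h0s : 0 <= s) (hst : s < t) (htT : t <= T)
    (alpha : R) (halpha_gt0 : 0 < alpha) (halpha : (alpha%:E <= poweR r p)%E) :
  (greedy_count (omega (Psi x)) (alpha%:E * poweR (lin_norm Psi r) p) s t
   <= greedy_count (omega x) alpha%:E s t)%E.
Proof.
have p0 : 0 < p := lt_le_trans ltr01 hp.
apply: greedy_count_le (ltW hst) _ => tau sigma u s_tau tau_sigma sigma_u ut.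
apply: contraTT; rewrite -!ltNge => x_alpha.
have {}x_alpha : (omega x sigma u < alpha%:E)%E.
  apply: le_lt_trans x_alpha.
  exact: poweR_pvariation_subitv (ltW sigma_u).
have x_ge0 : (0 <= pvar_norm p x sigma u)%E by exact: poweR_ge0.
(* Finiteness follows from [omega x sigma u] being below the real number [alpha]. *)
have x_fin : (pvar_norm p x sigma u < +oo)%E.
  by apply: (@lty_poweRy _ _ p); rewrite ?gt_eqF // (lt_trans x_alpha) ?ltry.
have x_r : (pvar_norm p x sigma u <= r)%E.
  (* Otherwise [alpha <= r^p <= omega x sigma u], against [x_alpha]. *)
  rewrite leNgt; apply/negP => /ltW r_x; move: x_alpha; apply/negP.
  rewrite -leNgt (le_trans halpha) // gt0_ler_poweR ?(ltW p0) //.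
    by rewrite in_itv /= leey (ltW hr).
  by rewrite in_itv /= leey x_ge0.
have K_p_fin : poweR (lin_norm Psi r) p \is a fin_num.
  by rewrite fin_num_poweR // ge0_fin_numE // ltW.
have K_p_gt0 : (0 < poweR (lin_norm Psi r) p)%E by exact: poweR_gt0.
(* The strict half multiplies [x_alpha] by [lin_norm Psi r ^ p], which keeps it strict since this
   factor is positive and finite. *)
apply: (@le_lt_trans _ _ (omega x sigma u * poweR (lin_norm Psi r) p)%E);
  last by rewrite lte_pmul2r.
rewrite muleC -poweRM ?(ltW hPsi_gt0) //.
have sigma0 : 0 <= sigma by rewrite (le_trans h0s) // (le_trans s_tau).
have Kx := pvariation_lin_norm _ _ _ _ _ _ _ _ _ _ _ _
  hPsi_fin sigma0 (ltW sigma_u) (le_trans ut htT) x_r x_fin.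
apply: gt0_ler_poweR Kx; rewrite ?(ltW p0) // in_itv /= leey andbT.
  exact: poweR_ge0.
by rewrite mule_ge0 // ltW.
Qed.
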